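(* Let $d\ge2$, $0<\varepsilon\le1$ and $\lambda>1$. Consider unit vectors $v_0,v_1,\dots,v_n$ in $\mathbb{R}^d$ and a family of linear maps $L_i:v_{i-1}^\perp\to v_i^\perp$, $1\le i\le n$, such that: 1. if $u\in v_{i-1}^\perp\cap v_i^\perp$ then $L_iu=u$; 2. if $\{v_{i-1},v_i\}$ are linearly independent and $u\in v_{i-1}^\perp\cap\operatorname{span}(v_{i-1},v_i)$, then $L_iu\in v_i^\perp\cap\operatorname{span}(v_{i-1},v_i)$ and $\|L_iu\|\ge\lambda\|u\|$; 3. for each $i=1,\dots,n$, either $v_i\in\operatorname{span}(v_0,\dots,v_{i-1})$ or else $\sin\angle(v_i,\operatorname{span}(v_0,\dots,v_{i-1}))\ge\varepsilon$. Then the composition $L^{(n)}:=L_n\circ\cdots\circ L_1:v_0^\perp\to v_n^\perp$ satisfies $\|L^{(n)}u\|\ge\sigma\|u\|$ for all $u\in v_0^\perp\cap\operatorname{span}(v_0,\dots,v_n)$, where $$\sigma=\frac{1}{\sqrt{\big(\oplus_{d-1}(1-\varepsilon^2)\big)\oplus\big(\oplus_{d}\lambda^{-2}\big)}}>1 .$$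
   Context: For $a,b\in[0,1]$, $a\oplus b:=a+b-ab$ (a commutative associative operation on $[0,1]$), and $\oplus_m x:=x\oplus\cdots\oplus x$ ($m$ terms). For a unit vector $v$, $v^\perp$ is its orthogonal hyperplane in $\mathbb{R}^d$. The angle between a nonzero vector $v$ and a subspace $E$ is $\angle(v,E)=\min_{u\in E\setminus\{0\}}\arccos\frac{\langle v,u\rangle}{\|v\|\|u\|}$. *)

(* Defs.v *)
From HB Require Import structures.
From mathcomp Require Import all_boot all_order all_algebra.
From mathcomp Require Import classical_sets reals trigo.

Set Implicit Arguments.
Unset Strict Implicit.
Unset Printing Implicit Defensive.

Import Order.TTheory GRing.Theory Num.Theory.

Local Open Scope ring_scope.

(* The norm that MathComp-Analysis puts on row vectors is the sup norm, and
   the dot product of spectral.v is over a numClosedFieldType; hence the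
   Euclidean structure of R^d is spelled out here. *)
Definition dotp (R : realType) (d : nat) (u v : 'rV[R]_d) : R :=
  \sum_(i < d) u 0 i * v 0 i.

Definition enorm (R : realType) (d : nat) (u : 'rV[R]_d) : R :=
  Num.sqrt (dotp u u).

(* The kernel of u |-> u *m v^T, whose unique entry is dotp u v. *)
Definition perp (R : realType) (d : nat) (v : 'rV[R]_d) : {vspace 'rV[R]_d} :=
  lker (linfun (mulmxr v^T : 'rV[R]_d -> 'rV[R]_1)).

Lemma mem_perp (R : realType) (d : nat) (u v : 'rV[R]_d) :
  (u \in perp v) = (dotp u v == 0).
Proof.
rewrite memv_ker lfunE /=.
have -> : dotp u v = (u *m v^T) 0 0.
  by rewrite mxE; apply: eq_bigr => i _; rewrite mxE.
apply/eqP/eqP => [-> | h]; first by rewrite mxE.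
by apply/rowP => j; rewrite (ord1 j) h mxE.
Qed.

(* For E different from 0 the infimum is attained, so it is the minimum. *)
Definition angle (R : realType) (d : nat) (v : 'rV[R]_d)
    (E : {vspace 'rV[R]_d}) : R :=
  inf [set a : R | exists u : 'rV[R]_d,
        [/\ u \in E, u != 0 & a = acos (dotp v u / (enorm v * enorm u))]]%classic.

Definition oplus (R : realType) (a b : R) : R := a + b - a * b.

(* iterop m op x 0 is x op (x op (... op x)) with m terms x, if m > 0. *)
Definition oplusn (R : realType) (m : nat) (x : R) : R :=
  iterop m (@oplus R) x 0.

(* L i maps (v i)^perp to (v i.+1)^perp, and the composite is
   L n.-1 \o ... \o L 0. *)
Fixpoint lcomp (R : realType) (d : nat) (v : nat -> 'rV[R]_d)
    (L : forall i : nat,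
       'Hom(subvs_of (perp (v i)), subvs_of (perp (v i.+1))))
    (n : nat) : 'Hom(subvs_of (perp (v 0)), subvs_of (perp (v n))) :=
  match n with
  | 0 => \1%VF
  | k.+1 => (L k \o lcomp L k)%VF
  end.

Definition sigma (R : realType) (d : nat) (eps lambda : R) : R :=
  1 / Num.sqrt (oplus (oplusn d.-1 (1 - eps ^+ 2)) (oplusn d (lambda ^- 2))).

(* Main.v *)
Require Import Defs.
From mathcomp Require Import all_boot all_order all_algebra.
From mathcomp Require Import reals trigo.
From mathcomp Require Import classical_sets ring lra.

Import Order.TTheory GRing.Theory Num.Theory.

Local Open Scope ring_scope.

(** Write [E_k = span(v_0, ..., v_k)], [p = 1 - lambda^-2] and
    [r_k = (p eps^2)^(dim E_k - 1)].  By induction on [k],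
    [|u|^2 <= (1 - r_k) |L^(k) u|^2] for [u] in [v_0^perp] and [E_k].
    A single step never contracts, and its gain in squared length is at least
    [(lambda^2 - 1) <u, v_(k+1)>^2 / (1 - <v_k, v_(k+1)>^2)].  If
    [v_(k+1) = P + g] with [P] in [E_k] and [0 != g] orthogonal to [E_k], then
    [u = u' + c g] with [u'] in [E_k]; the vector [g] is fixed by [L^(k)] and
    orthogonal to [L^(k) u'], so that the gain of the last step on
    [L^(k) u' + c g] and the gain of [L^(k)] on [u'] compensate each other.
    Finally [oplus_m x = 1 - (1 - x)^m], so that
    [1 - sigma^-2 = p^d eps^(2 (d - 1)) <= r_n]. *)

(** * Euclidean geometry of row vectors *)

Section DotProduct.
Set Implicit Arguments.
Unset Strict Implicit.
Variables (R : realType) (d : nat).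
Implicit Types (u v w x y : 'rV[R]_d).

Lemma dotpC u v : dotp u v = dotp v u.
Proof. by apply: eq_bigr => i _; rewrite mulrC. Qed.

Lemma dotpDl u v w : dotp (u + v) w = dotp u w + dotp v w.
Proof. by rewrite -big_split; apply: eq_bigr => i _; rewrite mxE mulrDl. Qed.

Lemma dotpZl (a : R) u w : dotp (a *: u) w = a * dotp u w.
Proof. by rewrite mulr_sumr; apply: eq_bigr => i _; rewrite mxE mulrA. Qed.

Lemma dotpNl u w : dotp (- u) w = - dotp u w.
Proof. by rewrite -scaleN1r dotpZl mulN1r. Qed.

Lemma dotpBl u v w : dotp (u - v) w = dotp u w - dotp v w.
Proof. by rewrite dotpDl dotpNl. Qed.

Lemma dotpDr w u v : dotp w (u + v) = dotp w u + dotp w v.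
Proof. by rewrite dotpC dotpDl !(dotpC w). Qed.

Lemma dotpZr (a : R) w u : dotp w (a *: u) = a * dotp w u.
Proof. by rewrite dotpC dotpZl (dotpC w). Qed.

Lemma dotpNr w u : dotp w (- u) = - dotp w u.
Proof. by rewrite dotpC dotpNl (dotpC w). Qed.

Lemma dotpBr w u v : dotp w (u - v) = dotp w u - dotp w v.
Proof. by rewrite dotpDr dotpNr. Qed.

Definition dotpE := (dotpDl, dotpNl, dotpZl, dotpDr, dotpNr, dotpZr).

Lemma dotp0r u : dotp u 0 = 0.
Proof. by rewrite -(scale0r u) dotpZr mul0r. Qed.

Lemma dotp_ge0 u : 0 <= dotp u u.
Proof. by apply: sumr_ge0 => i _; rewrite -expr2 sqr_ge0. Qed.

Lemma dotp_eq0 u : (dotp u u == 0) = (u == 0).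
Proof.
apply/eqP/eqP => [h|->]; last exact: dotp0r.
apply/rowP => j; rewrite mxE; apply/eqP.
have := h; move/eqP; rewrite psumr_eq0; last by move=> i _; rewrite -expr2 sqr_ge0.
by move/allP/(_ j (mem_index_enum j)); rewrite -expr2 sqrf_eq0.
Qed.

Lemma dotp_gt0 u : u != 0 -> 0 < dotp u u.
Proof. by move=> u0; rewrite lt_def dotp_eq0 u0 dotp_ge0. Qed.

Lemma enorm_ge0 u : 0 <= enorm u.
Proof. exact: sqrtr_ge0. Qed.

Lemma enorm_sqr u : enorm u ^+ 2 = dotp u u.
Proof. by rewrite sqr_sqrtr // dotp_ge0. Qed.

Lemma dotp_cauchy_schwarz u v : dotp u v ^+ 2 <= dotp u u * dotp v v.
Proof.
have [->|v0] := eqVneq v 0; first by rewrite !dotp0r expr0n mulr0.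
have vv := dotp_gt0 v0; rewrite -ler_pdivrMr // -subr_ge0.
have := dotp_ge0 (u - dotp u v / dotp v v *: v); rewrite !dotpE (dotpC v u).
rewrite [X in 0 <= X](_ : _ = dotp u u - dotp u v ^+ 2 / dotp v v) //.
by field; rewrite gt_eqF.
Qed.

(** Removing from [u] its component along the unit vector [x] does not change its product with [w];
    Cauchy-Schwarz is then applied to [w] and the remainder [z]. *)
Lemma bessel2 x w u : dotp x x = 1 -> dotp w x = 0 ->
  dotp x u ^+ 2 <= dotp u u /\
  dotp w u ^+ 2 <= dotp w w * (dotp u u - dotp x u ^+ 2).
Proof.
move=> xx wx; have [z zE] : exists z, z = u - dotp x u *: x by eexists.
have zz : dotp z z = dotp u u - dotp x u ^+ 2.
  by rewrite zE !dotpE xx (dotpC u x); ring.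
have wz : dotp w z = dotp w u by rewrite zE !dotpE wx mulr0 subr0.
by rewrite -wz -zz -subr_ge0 -zz dotp_ge0 dotp_cauchy_schwarz.
Qed.

(** * Orthogonal projection onto a span, and the angle with it *)

Lemma dotp_span (s : seq 'rV[R]_d) u w :
  {in s, forall x, dotp x w = 0} -> u \in <<s>>%VS -> dotp u w = 0.
Proof.
move=> h; suff /subvP sub : (<<s>> <= perp w)%VS.
  by move/sub; rewrite mem_perp => /eqP.
by apply/span_subvP => x xs; rewrite mem_perp h.
Qed.

(** Gram-Schmidt by induction on [s]: a new generator [a] contributes only its residual [a - b], and
    the projection of [y] gains its component along that residual. If the residual vanishes, the old
    projection [p] still works. *)
Lemma orthogonal_decomposition (s : seq 'rV[R]_d) y :
  exists2 x, x \in <<s>>%VS & {in <<s>>%VS, forall u, dotp u (y - x) = 0}.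
Proof.
elim: s y => [|a s IH] y.
  exists 0; first exact: mem0v.
  by move=> u; rewrite span_nil memv0 => /eqP ->; rewrite dotpC dotp0r.
have [p ps pP] := IH y; have [b bs bP] := IH a.
have sub : (<<s>> <= <<a :: s>>)%VS by rewrite span_cons addvSr.
have aS : a \in <<a :: s>>%VS by rewrite memv_span // mem_head.
have orth u : {in s, forall x, dotp x u = 0} -> dotp a u = 0 ->
    {in <<a :: s>>%VS, forall z, dotp z u = 0}.
  move=> hs ha z; apply: dotp_span => x; rewrite inE => /predU1P[->//|]; exact: hs.
have [ab0|ab0] := eqVneq (a - b) 0.
  exists p; first exact: (subvP sub).
  have ? : a = b by apply/eqP; rewrite -subr_eq0 ab0.
  subst b; apply: orth; last exact: pP.
  by move=> x xs; rewrite pP // memv_span.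
have D0 := dotp_gt0 ab0.
exists (p + dotp (a - b) y / dotp (a - b) (a - b) *: (a - b)).
  by rewrite memvD ?memvZ ?memvB // (subvP sub).
have e : y - (p + dotp (a - b) y / dotp (a - b) (a - b) *: (a - b)) =
   (y - p) - dotp (a - b) y / dotp (a - b) (a - b) *: (a - b).
  by rewrite opprD addrA.
rewrite e; apply: orth => [x xs|].
  by rewrite dotpBr dotpZr pP ?memv_span // (bP x) ?memv_span // mulr0 subr0.
rewrite dotpBr dotpZr.
have -> : dotp a (a - b) = dotp (a - b) (a - b).
  by rewrite [in RHS]dotpBl (bP b) // subr0.
rewrite divfK ?gt_eqF // -[dotp a _](subrK (dotp b (y - p))) -dotpBl (pP b) // addr0.
by rewrite dotpBr [dotp (a - b) p]dotpC (bP p) // subr0 subrr.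
Qed.

(** The projection [x] is one of the vectors over which the infimum runs, and its angle with [y] has
    cosine [enorm x]. So the infimum has cosine at least [enorm x], and Pythagoras bounds its
    sine. *)
Lemma sin_angle_le (s : seq 'rV[R]_d) x y :
  enorm y = 1 -> x \in <<s>>%VS -> {in <<s>>%VS, forall u, dotp u (y - x) = 0} ->
  x != 0 -> sin (angle y <<s>>%VS) <= enorm (y - x).
Proof.
move=> y1 xs orth x0.
have xx : dotp y x = dotp x x.
  by have := orth x xs; rewrite dotpBr dotpC => /subr0_eq.
have yy : dotp y y = 1 by rewrite -enorm_sqr y1 expr1n.
have pyth : dotp (y - x) (y - x) = 1 - dotp x x.
  by rewrite !dotpE (dotpC x y) xx yy; ring.
have ex_gt0 : 0 < enorm x by rewrite sqrtr_gt0 dotp_gt0.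
have ex_le1 : enorm x <= 1.
  rewrite -(@ler_pXn2r _ 2) ?nnegrE ?enorm_ge0 // enorm_sqr expr1n.
  by have := dotp_ge0 (y - x); rewrite pyth subr_ge0.
have exI : -1 <= enorm x <= 1 by rewrite ex_le1 (le_trans _ (ltW ex_gt0)) ?lerN10.
set A := [set a : R | exists u : 'rV[R]_d,
        [/\ u \in <<s>>%VS, u != 0 & a = acos (dotp y u / (enorm y * enorm u))]]%classic.
have Ax : A (acos (enorm x)).
  exists x; split=> //; congr acos.
  by rewrite xx y1 mul1r -enorm_sqr expr2 mulfK // gt_eqF.
(* An upper bound on [inf A] requires [A] to be bounded below; Cauchy-Schwarz keeps the arguments of
   [acos] in [-1, 1]. *)
have A0 : lbound A 0.
  move=> _ [u [us u0 ->]]; rewrite acos_ge0 // y1 mul1r.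
  have eu : 0 < enorm u by rewrite sqrtr_gt0 dotp_gt0.
  have cs : `|dotp y u / enorm u| <= 1.
    rewrite -(@ler_pXn2r _ 2) ?nnegrE // real_normK ?num_real // expr1n.
    rewrite exprMn exprVn enorm_sqr ler_pdivrMr ?dotp_gt0 // mul1r.
    by have := dotp_cauchy_schwarz y u; rewrite yy mul1r.
  by rewrite -ler_norml.
have le1 : angle y <<s>>%VS <= acos (enorm x).
  by apply: ge_inf => //; exists 0.
have ge1 : 0 <= angle y <<s>>%VS.
  by apply: lb_le_inf => //; exists (acos (enorm x)).
have t_le : enorm x <= cos (angle y <<s>>%VS).
  rewrite -[leLHS]acosK ?in_itv // leNgt; apply/negP.
  have ple := acos_lepi exI.
  rewrite ltr_cos ?in_itv /= ?ge1 ?(le_trans le1) ?acos_ge0 //.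
  by rewrite ltNge le1.
have -> : enorm (y - x) = Num.sqrt (1 - enorm x ^+ 2) by rewrite enorm_sqr /enorm pyth.
apply: le_trans (ler_norm _) _.
rewrite -sqrtr_sqr ler_wsqrtr // -(cos2Dsin2 (angle y <<s>>%VS)) lerBrDr addrC lerD2r.
by rewrite ler_pXn2r ?nnegrE ?enorm_ge0 // (le_trans (ltW ex_gt0)).
Qed.

Lemma sin_angle_decomposition (s : seq 'rV[R]_d) y (eps : R) :
  enorm y = 1 -> 0 < eps <= 1 -> eps <= sin (angle y <<s>>%VS) ->
  exists x, [/\ x \in <<s>>%VS, {in <<s>>%VS, forall u, dotp u (y - x) = 0}
    & eps ^+ 2 <= dotp (y - x) (y - x)].
Proof.
move=> y1 /andP[e0 e1] le_sin; have [x xs xP] := orthogonal_decomposition s y.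
exists x; split=> //; rewrite -enorm_sqr ler_pXn2r ?nnegrE ?enorm_ge0 ?(ltW e0) //.
(* If [y] is orthogonal to the span, no angle is used: the distance is 1 and [eps <= 1] suffices. *)
have [->|x0] := eqVneq x 0; first by rewrite subr0 y1.
exact: le_trans le_sin (sin_angle_le y1 xs xP x0).
Qed.

(** * The gain of a single step *)

(** In the independent case split [a = t *: e + h], where [e] spans the line of [span(x, y)]
    orthogonal to [x], and [h] is orthogonal to both [x] and [y]. Then [f] fixes [h] and stretches
    [e] inside the plane, so all the gain comes from [t *: e]. Multiplying by [1 - dotp x y ^+ 2]
    instead of dividing keeps the degenerate case in the same formula. *)
Lemma perp_step x y (f : 'Hom(subvs_of (perp x), subvs_of (perp y))) (lambda : R) :
  enorm x = 1 -> enorm y = 1 -> 1 < lambda ->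
  (forall u : subvs_of (perp x), vsval u \in perp y -> vsval (f u) = vsval u) ->
  (free [:: x; y] -> forall u : subvs_of (perp x), vsval u \in <<[:: x; y]>>%VS ->
     vsval (f u) \in <<[:: x; y]>>%VS /\
     lambda * enorm (vsval u) <= enorm (vsval (f u))) ->
  forall u : subvs_of (perp x), let a := vsval u in let b := vsval (f u) in
    [/\ b - a \in <<[:: x; y]>>%VS, dotp a a <= dotp b b &
      (lambda ^+ 2 - 1) * dotp a y ^+ 2 <=
        (dotp b b - dotp a a) * (1 - dotp x y ^+ 2)].
Proof.
move=> x1 y1 l1 f_fix f_exp u a b.
have xx : dotp x x = 1 by rewrite -enorm_sqr x1 expr1n.
have yy : dotp y y = 1 by rewrite -enorm_sqr y1 expr1n.
have ax : dotp a x = 0 by apply/eqP; rewrite -mem_perp subvsP.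
have xS : x \in <<[:: x; y]>>%VS by rewrite memv_span // mem_head.
have yS : y \in <<[:: x; y]>>%VS by rewrite memv_span // !inE eqxx orbT.
set s := dotp x y; have [e eE] : exists e, e = y - s *: x by exists (y - s *: x).
have ex : dotp e x = 0 by rewrite eE !dotpE xx (dotpC y) -/s mulr1 subrr.
have ey : dotp e y = 1 - s ^+ 2 by rewrite eE !dotpE yy -/s expr2.
have ee : dotp e e = 1 - s ^+ 2 by rewrite [X in dotp _ X]eE !dotpE ex ey; ring.
(* If [x] and [y] are proportional, [a] is orthogonal to [y] too, hence fixed by [f], and both sides
   of the gain inequality vanish. *)
have [fr|] := boolP (free [:: x; y]); last first.
  have x0 : x != 0 by rewrite -dotp_eq0 xx oner_eq0.
  have y0 : y != 0 by rewrite -dotp_eq0 yy oner_eq0.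
  rewrite free_cons seq1_free y0 andbT negbK span_seq1 => /vlineP[k xk].
  have k0 : k != 0 by apply: contraNneq x0 => k0; rewrite xk k0 scale0r.
  have ay : dotp a y = 0.
    by apply/eqP; move/eqP: ax; rewrite xk dotpZr mulf_eq0 (negPf k0).
  have -> : b = a by apply: f_fix; rewrite mem_perp ay.
  by split=> //; rewrite ?subrr ?mem0v // ay expr0n mulr0 mul0r.
have eS : e \in <<[:: x; y]>>%VS by rewrite eE memvB ?memvZ.
have e0 : e != 0.
  apply: contraTneq fr; rewrite eE => /subr0_eq ->.
  by rewrite -cat1s (perm_free (permEl (perm_catC _ _))) /= free_cons span_seq1 memvZ ?memv_line.
have D0 : 0 < 1 - s ^+ 2 by rewrite -ee dotp_gt0.
have ep : e \in perp x by rewrite mem_perp ex.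
(* This [t] makes [h] orthogonal to [y], since [dotp e y = 1 - s ^+ 2]. *)
pose t := dotp a y / (1 - s ^+ 2).
have [h hE] : exists h, h = a - t *: e by exists (a - t *: e).
have hx : dotp h x = 0 by rewrite hE !dotpE ax ex; ring.
have hy : dotp h y = 0 by rewrite hE dotpBl dotpZl ey divfK ?gt_eqF // subrr.
have hp : h \in perp x by rewrite mem_perp hx.
have hS z : z \in <<[:: x; y]>>%VS -> dotp z h = 0.
  by apply: dotp_span => w; rewrite !inE => /orP[] /eqP ->; rewrite dotpC.
have [feS fe_ge] := f_exp fr (vsproj _ e) (etrans (congr1 _ (vsprojK ep)) eS).
set c := vsval (f (vsproj _ e)) in feS fe_ge.
rewrite vsprojK // in fe_ge.
have uE : u = t *: vsproj _ e + vsproj _ h.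
  by apply: subvs_inj; rewrite linearP /= !vsprojK // hE addrC subrK.
have bE : b = t *: c + h.
  rewrite /b uE linearP linearP /= -/c; congr (_ + _).
  by rewrite f_fix vsprojK // mem_perp hy.
have aE : a = t *: e + h by rewrite hE addrC subrK.
have cc : lambda ^+ 2 * (1 - s ^+ 2) <= dotp c c.
  rewrite -ee -!enorm_sqr -exprMn ler_pXn2r ?nnegrE ?mulr_ge0 ?enorm_ge0 //.
  by rewrite ltW // (lt_trans _ l1).
have bb : dotp b b = t ^+ 2 * dotp c c + dotp h h.
  by rewrite bE !dotpE (dotpC h c) (hS c) //; ring.
have aa : dotp a a = t ^+ 2 * (1 - s ^+ 2) + dotp h h.
  by rewrite aE !dotpE (dotpC h e) (hS e) // ee; ring.
have l2 : 1 < lambda ^+ 2 by rewrite expr_gt1 // ltW // (lt_trans _ l1).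
have ba : t ^+ 2 * ((lambda ^+ 2 - 1) * (1 - s ^+ 2)) <= dotp b b - dotp a a.
  have -> : dotp b b - dotp a a = t ^+ 2 * (dotp c c - (1 - s ^+ 2)).
    by rewrite bb aa; ring.
  by rewrite ler_wpM2l ?sqr_ge0 // mulrBl mul1r lerD2r.
have ay : dotp a y = t * (1 - s ^+ 2) by rewrite divfK ?gt_eqF.
split.
- have -> : b - a = t *: (c - e) by rewrite bE aE opprD addrACA subrr addr0 -scalerBr.
  by rewrite memvZ // memvB.
- rewrite -subr_ge0 (le_trans _ ba) // mulr_ge0 ?sqr_ge0 // mulr_ge0 ?ltW // subr_gt0 //.
rewrite ay (_ : _ * _ = t ^+ 2 * ((lambda ^+ 2 - 1) * (1 - s ^+ 2)) * (1 - s ^+ 2)).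
  by rewrite ler_wpM2r // ltW.
by ring.
Qed.

End DotProduct.

(** * Scalar inequalities behind the induction step *)

(* Multiplied by [1 - G] and with [W (1 - G)] replaced by [q ^+ 2], the
   difference of the two sides is [((1 - p) q + p (1 - G) z) ^+ 2]. *)
Lemma gain_core (R : realType) (p G W q z : R) :
  0 < p < 1 -> 0 < G <= 1 -> 0 <= W -> q ^+ 2 <= W * (1 - G) ->
  (1 - p) * p * (z - q) ^+ 2 <= (1 - p * G) * ((1 - p) * W + p * z ^+ 2).
Proof.
move=> /andP[p0 p1] /andP[G0]; rewrite le_eqVlt => /predU1P[->|G1] W0 hq.
  (* For [G = 1] the factor [1 - G] vanishes, but [hq] then forces [q = 0]. *)
  have /eqP -> : q == 0.
    by rewrite -sqrf_eq0 eq_le sqr_ge0 andbT (le_trans hq) // subrr mulr0.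
  rewrite subr0 mulr1 -mulrA ler_wpM2l ?subr_ge0 ?(ltW p1) //.
  by rewrite lerDr mulr_ge0 // subr_ge0 ltW.
rewrite -(@ler_pM2r _ (1 - G)) ?subr_gt0 //.
have pG : p * G <= 1 by rewrite -(mulr1 1) ler_pM // ltW.
have : (1 - p * G) * (1 - p) * q ^+ 2 <= (1 - p * G) * (1 - p) * (W * (1 - G)).
  by rewrite ler_wpM2l // mulr_ge0 // subr_ge0 // ltW.
have := sqr_ge0 ((1 - p) * q + p * (1 - G) * z).
lra.
Qed.

(** Dictionary for its use, with w the image of u' under L^(k): [W] = |w|^2, [G] = |g|^2, [B] = |c
    g|^2, [T] = |L^(k+1) u|^2, [q] = <w, v_(k+1)>, [b] = <c g, v_(k+1)>, [D] = 1 - <v_k, v_(k+1)>^2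
    and [k] = lambda^2 - 1. A cancellation between [q] and [b] can make the last gain small;
    [gain_core] with [z = q + b] limits the resulting loss. *)
Lemma gain_step (R : realType) (k p r e2 W G D q b B T : R) :
  0 < k -> p * (1 + k) = k -> 0 <= r <= 1 -> 0 < e2 <= G -> G <= D <= 1 ->
  0 <= W -> 0 <= B -> q ^+ 2 <= W * (D - G) -> b ^+ 2 = G * B ->
  W + B <= T -> k * (q + b) ^+ 2 <= (T - (W + B)) * D ->
  (1 - r) * W + B <= (1 - r * (p * e2)) * T.
Proof.
move=> k0 pk /andP[r0 r1] /andP[e0 eG] /andP[GD D1] W0 B0 hq hb WT hT.
have p0 : 0 < p by rewrite -(@pmulr_lgt0 _ (1 + k)) ?pk // addr_gt0.
have p1 : p < 1 by nra.
have G0 := lt_le_trans e0 eG.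
(* As [D <= 1], both hypotheses containing [D] may be weakened by putting 1 in its place. *)
have hq' : q ^+ 2 <= W * (1 - G) by rewrite (le_trans hq) // ler_wpM2l // lerD2r.
have hT' : k * (q + b) ^+ 2 <= T - (W + B).
  by rewrite (le_trans hT) // ler_piMr // subr_ge0.
have p01 : 0 < p < 1 by rewrite p0.
have G01 : 0 < G <= 1 by rewrite G0 (le_trans GD).
have core := gain_core (q + b) p01 G01 W0 hq'.
have core' : p * b ^+ 2 <= (1 - p * G) * (W + k * (q + b) ^+ 2).
  rewrite -(@ler_pM2l _ (1 - p)) ?subr_gt0 //.
  have kp : (1 - p) * k = p by lra.
  have e1 : (1 - p) * (p * b ^+ 2) = (1 - p) * p * (q + b - q) ^+ 2 by ring.
  have e3 : (1 - p) * ((1 - p * G) * (W + k * (q + b) ^+ 2)) =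
    (1 - p * G) * ((1 - p) * W + (1 - p) * k * (q + b) ^+ 2) by ring.
  by rewrite e1 e3 kp.
have pG1 : p * G <= 1 by rewrite -(mulr1 1) ler_pM ?(ltW p0) ?(ltW p1) ?(ltW G0) ?(le_trans GD).
have peG : r * (p * e2) <= r * (p * G) by rewrite ler_wpM2l // ler_wpM2l //; exact: ltW.
have rpG : r * (p * G) <= p * G by rewrite ler_piMl // mulr_ge0 // ltW.
have i1 : r * (p * e2) * (W + B) <= r * (p * G) * (W + B).
  by rewrite ler_wpM2r // addr_ge0.
have i2 : (1 - p * G) * (r * (k * (q + b) ^+ 2)) <= (1 - r * (p * e2)) * (T - (W + B)).
  have z0 : 0 <= k * (q + b) ^+ 2 by rewrite mulr_ge0 ?sqr_ge0 ?ltW.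
  apply: ler_pM; first by rewrite subr_ge0.
  - by rewrite mulr_ge0.
  - by rewrite lerD2l lerN2 (le_trans peG).
  by rewrite (le_trans _ hT') // ler_piMl.
have i3 : r * (p * b ^+ 2) <= r * ((1 - p * G) * (W + k * (q + b) ^+ 2)).
  by rewrite ler_wpM2l.
(* With [b ^+ 2 = G * B], adding [i1], [i2] and [i3] gives the claim; the terms [r * p * G * W]
   cancel. *)
rewrite hb in i3; lra.
Qed.

(** * Induction along the composition *)

Lemma span_mkseqS (R : realType) (d : nat) (v : nat -> 'rV[R]_d) k :
  <<mkseq v k.+1>>%VS = (<<mkseq v k>> + <[v k]>)%VS.
Proof. by rewrite mkseqS -cats1 span_cat span_seq1. Qed.

Lemma memv_span_mkseq (R : realType) (d : nat) (v : nat -> 'rV[R]_d) k i :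
  (i < k)%N -> v i \in <<mkseq v k>>%VS.
Proof. by move=> ik; rewrite memv_span // map_f // mem_iota. Qed.

Section Composition.
Variables (R : realType) (d : nat) (eps lambda : R) (n : nat).
Variable v : nat -> 'rV[R]_d.
Variable L : forall i : nat, 'Hom(subvs_of (perp (v i)), subvs_of (perp (v i.+1))).
Hypotheses (eps_gt0 : 0 < eps) (eps_le1 : eps <= 1) (lambda_gt1 : 1 < lambda).
Hypothesis v_unit : forall i : nat, (i <= n)%N -> enorm (v i) = 1.
Hypothesis L_fix : forall i : nat, (i < n)%N ->
  forall u : subvs_of (perp (v i)),
    vsval u \in perp (v i.+1) -> vsval (L i u) = vsval u.
Hypothesis L_expand : forall i : nat, (i < n)%N ->
  free [:: v i; v i.+1] ->
  forall u : subvs_of (perp (v i)),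
    vsval u \in <<[:: v i; v i.+1]>>%VS ->
    vsval (L i u) \in <<[:: v i; v i.+1]>>%VS /\
    lambda * enorm (vsval u) <= enorm (vsval (L i u)).
Hypothesis v_angle : forall i : nat, (1 <= i <= n)%N ->
  v i \in <<mkseq v i>>%VS \/ eps <= sin (angle (v i) <<mkseq v i>>%VS).

Let E k := <<mkseq v k.+1>>%VS.
Let p := 1 - lambda ^- 2.

(** At each stage the vector is orthogonal to the next [v i], so [L_fix] applies. This serves for
    the component [g] of a new direction. *)
Lemma lcomp_orthogonal k (u : subvs_of (perp (v 0))) : (k <= n)%N ->
  (forall i, (i <= k)%N -> dotp (vsval u) (v i) = 0) ->
  vsval (lcomp L k u) = vsval u.
Proof.
elim: k => [|k IH] kn h; first by rewrite /= lfunE.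
have IHk : vsval (lcomp L k u) = vsval u.
  by apply: IH => [|i ik]; [exact: ltnW | apply: h; exact: leqW].
by rewrite /= lfunE /= L_fix // IHk // mem_perp h.
Qed.

Lemma lambda_factor_bounds : 0 < p < 1.
Proof.
have l0 : 0 < lambda by rewrite (lt_trans _ lambda_gt1).
rewrite /p subr_gt0 ltrBlDr ltrDl invr_gt0 exprn_gt0 // andbT.
by rewrite invf_lt1 ?exprn_gt0 // expr_gt1 // ltW.
Qed.

Lemma ratio_bounds m : 0 <= (p * eps ^+ 2) ^+ m <= 1.
Proof.
have /andP[p0 p1] := lambda_factor_bounds.
have e2 : eps ^+ 2 <= 1 by rewrite expr_le1 // ltW.
have x0 : 0 <= p * eps ^+ 2 by rewrite mulr_ge0 ?sqr_ge0 // ltW.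
by rewrite exprn_ge0 //= exprn_ile1 // mulr_ile1 ?sqr_ge0 ?(ltW p0) ?(ltW p1).
Qed.

(** Membership of [w] in [E k] is carried through the induction because it makes [w] orthogonal to
    [g]. The ratio changes only when the dimension of [E k] grows. *)
Lemma lcomp_expand k (u : subvs_of (perp (v 0))) : (k <= n)%N ->
  vsval u \in E k ->
  let w := vsval (lcomp L k u) in
  w \in E k /\
  dotp (vsval u) (vsval u) <= (1 - (p * eps ^+ 2) ^+ (\dim (E k)).-1) * dotp w w.
Proof.
elim: k u => [|k IH] u kn uE /=.
  (* [E 0] is the line of [v 0], so [u] is both a multiple of [v 0] and orthogonal to it; the ratio
     bound reads 0 <= 0. *)
  have u0 : vsval u = 0.
    move: uE; rewrite /E /= span_seq1 => /vlineP[a ua].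
    have := subvsP u; rewrite mem_perp ua dotpZl -enorm_sqr v_unit // expr1n mulr1.
    by move=> /eqP ->; rewrite scale0r.
  by rewrite lfunE /= u0 mem0v dotp0r mulr0.
rewrite lfunE /=.
have kn' := ltnW kn.
have step := perp_step (v_unit kn') (v_unit kn) lambda_gt1 (L_fix kn) (L_expand kn).
have ES : E k.+1 = (E k + <[v k.+1]>)%VS by rewrite /E span_mkseqS.
have vkE : v k \in E k by apply: memv_span_mkseq.
have vSE : v k.+1 \in E k.+1 by apply: memv_span_mkseq.
have subE : (E k <= E k.+1)%VS by rewrite ES addvSl.
have pairE : (<<[:: v k; v k.+1]>> <= E k.+1)%VS.
  apply/span_subvP => z; rewrite !inE => /orP[] /eqP -> //; exact: (subvP subE).
have stepE w : vsval w \in E k.+1 -> vsval (L k w) \in E k.+1.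
  move=> wE; have [dw _ _] := step w.
  by rewrite -(subrK (vsval w) (vsval (L k w))) memvD // (subvP pairE).
(* If no new direction appears, the span and the ratio stay the same, and it is enough that the step
   does not contract. *)
have [vE|vE] := boolP (v k.+1 \in E k).
  have EE : E k.+1 = E k by rewrite ES; apply/addv_idPl; rewrite -memvE.
  rewrite EE in uE *; have [wE le] := IH u kn' uE.
  split; first by rewrite -EE stepE // EE.
  apply: le_trans le _; rewrite ler_wpM2l //; last by case: (step (lcomp L k u)).
  by rewrite subr_ge0; case/andP: (ratio_bounds (\dim (E k)).-1).
have [//|ang] := @v_angle k.+1 kn; first by move=> h; rewrite h in vE.
have eps_bounds : 0 < eps <= 1 by rewrite eps_gt0.
have [P [PE orth G_ge]] := sin_angle_decomposition (v_unit kn) eps_bounds ang.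
have [g gE] : exists g, g = v k.+1 - P by exists (v k.+1 - P).
rewrite -gE in orth G_ge.
have vg : v k.+1 = P + g by rewrite gE addrC subrK.
have gv i : (i <= k)%N -> dotp g (v i) = 0.
  by move=> ik; rewrite dotpC orth // memv_span_mkseq.
(* Replacing [v k.+1] by [P + g] absorbs [c *: P] into the part lying in [E k]. *)
have [u' u'E [c uc]] : exists2 u', u' \in E k & exists c, vsval u = u' + c *: g.
  move: uE; rewrite ES => /memv_addP[a aE [b /vlineP[c ->] ->]].
  exists (a + c *: P); first by rewrite memvD // memvZ.
  by exists c; rewrite vg scalerDr addrA.
have g0 : g \in perp (v 0) by rewrite mem_perp gv.
have u'0 : u' \in perp (v 0).
  by rewrite (_ : u' = vsval u - c *: g) ?memvB ?memvZ ?subvsP // uc addrK.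
have uEq : u = c *: vsproj _ g + vsproj _ u'.
  by apply: subvs_inj; rewrite linearP /= !vsprojK // uc addrC.
have := IH (vsproj _ u') kn'; rewrite vsprojK // => /(_ u'E) [wE le].
set w := vsval (lcomp L k (vsproj _ u')) in wE le.
have xE : vsval (lcomp L k u) = c *: g + w.
  rewrite uEq !linearP /= lcomp_orthogonal ?vsprojK //.
have xES : vsval (lcomp L k u) \in E k.+1.
  by rewrite xE memvD ?(subvP subE w) // memvZ // gE memvB // (subvP subE).
split; first exact: stepE.
have [_ le1 le2] := step (lcomp L k u); move: le1 le2; rewrite xE.
set T := dotp (vsval (L k _)) _.
have wg : dotp w g = 0 by exact: orth.
have gg : dotp g (v k.+1) = dotp g g by rewrite vg dotpDr dotpC orth // add0r.
have -> : dotp (c *: g + w) (c *: g + w) = dotp w w + c ^+ 2 * dotp g g.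
  by rewrite !dotpE (dotpC g w) wg; ring.
have -> : dotp (c *: g + w) (v k.+1) = dotp w (v k.+1) + c * dotp g g.
  by rewrite !dotpE gg addrC.
move=> le1 le2.
have dimE : (\dim (E k.+1)).-1 = (\dim (E k)).-1.+1.
  have vS0 : v k.+1 != 0 by apply: contraNneq vE => ->; exact: mem0v.
  (* [E k] is nonzero, so the predecessor of its dimension is not truncated. *)
  have vk0 : v k != 0 by rewrite -dotp_eq0 -enorm_sqr v_unit // expr1n oner_eq0.
  rewrite ES dimv_disjoint_sum ?dim_vline ?vS0 ?addn1.
    rewrite prednK // lt0n dimv_eq0; apply: contraNneq vk0 => E0.
    by rewrite -memv0 -E0.
  apply/eqP; rewrite -subv0; apply/subvP => z /memv_capP[zE /vlineP[a za]].
  have [a0|a0] := eqVneq a 0; first by rewrite za a0 scale0r mem0v.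
  case/negP: vE; rewrite -[v k.+1]scale1r -(mulVf a0) -scalerA -za.
  exact: memvZ.
have l1 : 1 < lambda ^+ 2 by rewrite expr_gt1 // ltW // (lt_trans _ lambda_gt1).
have u'g : dotp u' g = 0 by exact: orth.
have -> : dotp (vsval u) (vsval u) = dotp u' u' + c ^+ 2 * dotp g g.
  by rewrite uc !dotpE (dotpC g u') u'g; ring.
rewrite dimE (exprSr (p * eps ^+ 2)).
apply: le_trans (_ : _ <= (1 - (p * eps ^+ 2) ^+ (\dim (E k)).-1) * dotp w w + c ^+ 2 * dotp g g) _.
  by rewrite lerD2r.
have xx : dotp (v k) (v k) = 1 by rewrite -enorm_sqr v_unit // expr1n.
have PP : dotp P P = 1 - dotp g g.
  have := v_unit kn; move/(congr1 (fun a => a ^+ 2)); rewrite enorm_sqr expr1n.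
  rewrite vg !dotpE (dotpC g P) (orth _ PE) addr0 add0r => <-.
  by rewrite addrK.
have sP : dotp (v k) (v k.+1) = dotp (v k) P by rewrite vg dotpDr (orth _ vkE) addr0.
have qP : dotp w (v k.+1) = dotp w P by rewrite vg dotpDr wg addr0.
have wx : dotp w (v k) = 0 by apply/eqP; rewrite -mem_perp subvsP.
have [bes1 bes2] := bessel2 P xx wx.
(* Here [D - G] = |P|^2 - <v_k, P>^2 is the squared length of the part of [P] orthogonal to [v k];
   [bessel2] thus yields both [G <= D] and the bound on [q]. *)
apply: (gain_step (k := lambda ^+ 2 - 1) (G := dotp g g) (q := dotp w (v k.+1))
   (D := 1 - dotp (v k) (v k.+1) ^+ 2) (b := c * dotp g g)).
- by rewrite subr_gt0.
- rewrite addrC subrK mulrBl mul1r mulVf // expf_neq0 // gt_eqF //.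
  exact: lt_trans lambda_gt1.
- exact: ratio_bounds.
- by rewrite exprn_gt0.
- rewrite sP lerBlDr lerDl sqr_ge0 andbT.
  by rewrite lerBrDr addrC -lerBrDr -PP.
- exact: dotp_ge0.
- by rewrite mulr_ge0 ?sqr_ge0 ?dotp_ge0.
- by rewrite qP sP (le_trans bes2) // PP le_eqVlt; apply/orP; left; apply/eqP; ring.
- by ring.
- exact: le1.
- exact: le2.
Qed.

End Composition.

(** * Comparison of the ratio with [sigma] *)

Theorem lemma5p18 (R : realType) (d : nat) (hd : (2 <= d)%N)
  (eps lambda : R) (eps_gt0 : 0 < eps) (eps_le1 : eps <= 1)
  (lambda_gt1 : 1 < lambda)
  (n : nat) (v : nat -> 'rV[R]_d)
  (v_unit : forall i : nat, (i <= n)%N -> enorm (v i) = 1)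
  (L : forall i : nat, 'Hom(subvs_of (perp (v i)), subvs_of (perp (v i.+1))))
  (L_fix : forall i : nat, (i < n)%N ->
     forall u : subvs_of (perp (v i)),
       vsval u \in perp (v i.+1) -> vsval (L i u) = vsval u)
  (L_expand : forall i : nat, (i < n)%N ->
     free [:: v i; v i.+1] ->
     forall u : subvs_of (perp (v i)),
       vsval u \in <<[:: v i; v i.+1]>>%VS ->
       vsval (L i u) \in <<[:: v i; v i.+1]>>%VS /\
       lambda * enorm (vsval u) <= enorm (vsval (L i u)))
  (v_angle : forall i : nat, (1 <= i <= n)%N ->
     v i \in <<mkseq v i>>%VS \/ eps <= sin (angle (v i) <<mkseq v i>>%VS)) :
  1 < sigma d eps lambda /\
  (forall u : subvs_of (perp (v 0%N)),
     vsval u \in <<mkseq v n.+1>>%VS ->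
     sigma d eps lambda * enorm (vsval u) <= enorm (vsval (lcomp L n u))).
Proof.
(* The substitution of 1 - x for x turns [oplus] into multiplication. One term is a separate base
   case, since [iterop] then returns [x] without applying the operation. *)
have oplusnE m (x : R) : oplusn m x = 1 - (1 - x) ^+ m.
  elim: m => [|[|m] IHm]; first by rewrite expr0 subrr.
    by rewrite expr1 opprB addrC subrK.
  have -> : oplusn m.+2 x = oplus x (oplusn m.+1 x) by [].
  by rewrite IHm /oplus (exprS _ m.+1); ring.
set p := 1 - lambda ^- 2.
pose rho := p ^+ d * (eps ^+ 2) ^+ d.-1.
have rhoE : oplus (oplusn d.-1 (1 - eps ^+ 2)) (oplusn d (lambda ^- 2)) = 1 - rho.
  by rewrite !oplusnE /oplus -/p subKr /rho; ring.
have /andP[p0 p1] : 0 < p < 1 by exact: lambda_factor_bounds lambda_gt1.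
have e20 : 0 < eps ^+ 2 by rewrite exprn_gt0.
have e21 : eps ^+ 2 <= 1 by rewrite expr_le1 // ltW.
have rho0 : 0 < rho by rewrite mulr_gt0 // exprn_gt0.
(* Here [m] stands for dim E_n, at most [d]. Both bases are at most 1, and the exponents in [rho]
   are at least [m.-1]. *)
have rho_le m : (m <= d)%N -> rho <= (p * eps ^+ 2) ^+ m.-1.
  move=> md; rewrite exprMn ler_pM ?exprn_ge0 ?(ltW p0) ?(ltW eps_gt0) //.
    by rewrite ler_wiXn2l ?(ltW p0) ?(ltW p1) // (leq_trans (leq_pred m)).
  by rewrite ler_wiXn2l ?(ltW e20) // -!subn1 leq_sub2r.
have rho1 : rho < 1.
  rewrite (@le_lt_trans _ _ (p ^+ d)) //.
    by rewrite ler_piMr ?exprn_ge0 ?exprn_ile1 ?(ltW p0) ?(ltW eps_gt0) ?(ltW e20).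
  by rewrite exprn_ilt1 ?(ltW p0) // -lt0n (leq_trans _ hd).
(* Positivity excludes the default values of the square root and of the inverse. *)
have s0 : 0 < Num.sqrt (1 - rho) by rewrite sqrtr_gt0 subr_gt0.
rewrite /sigma rhoE; split.
  by rewrite ltr_pdivlMr // mul1r -[ltRHS]sqrtr1 ltr_sqrt // ltrBlDr ltrDl.
move=> u uE.
have [_ le] := lcomp_expand eps_gt0 eps_le1 lambda_gt1 v_unit L_fix L_expand v_angle (leqnn n) uE.
rewrite mulrAC mul1r ler_pdivrMr // -(@ler_pXn2r _ 2) ?nnegrE ?mulr_ge0 ?enorm_ge0 ?(ltW s0) //.
rewrite exprMn !enorm_sqr sqr_sqrtr ?subr_ge0 ?(ltW rho1) // mulrC.
rewrite (le_trans le) // ler_wpM2r ?dotp_ge0 // lerD2l lerN2 rho_le //.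
by rewrite (leq_trans (dimvS (subvf _))) // dimvf /dim /= mul1n.
Qed.
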